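(* Let $s\in\mathbb N$, $\alpha>1/2$, $\boldsymbol\gamma\in(0,\infty)^s$. There is a constant $C(\alpha,\boldsymbol\gamma,s)>0$ such that for every $N\ge2$, every point set $P=\{\boldsymbol x_0,\dots,\boldsymbol x_{N-1}\}\subseteq[0,1]^s$ and every weight vector $\boldsymbol w=(w_0,\dots,w_{N-1})\in\mathbb R^N$, $$e(\mathcal H(K^{\cos}_{\alpha,\boldsymbol\gamma,s});P;\boldsymbol w)\ge C(\alpha,\boldsymbol\gamma,s)\frac{(\log N)^{(s-1)/2}}{N^\alpha}.$$
   Context: $r_{\alpha,\gamma}(0)=1$, $r_{\alpha,\gamma}(h)=\gamma|h|^{-2\alpha}$ ($h\ne0$). $\mathcal H(K^{\cos}_{\alpha,\boldsymbol\gamma,s})$ is the reproducing kernel Hilbert space on $[0,1]^s$ with kernel $\prod_{j=1}^s\big(1+\sum_{k\ge1}r_{\alpha,\gamma_j}(k)2\cos(\pi kx_j)\cos(\pi ky_j)\big)$ and norm $\|\cdot\|$. The weighted worst-case error is $e(\mathcal H;P;\boldsymbol w)=\sup_{f\in\mathcal H,\|f\|\le1}\big|\int_{[0,1]^s}f(\boldsymbol x)\,d\boldsymbol x-\sum_{n=0}^{N-1}w_nf(\boldsymbol x_n)\big|$. *)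

(* Defs.v *)
From Stdlib Require Import Reals Lra List.
Import ListNotations.
Open Scope R_scope.

Fixpoint fsum (M : nat) (g : nat -> R) : R :=
  match M with O => 0 | S M' => fsum M' g + g M' end.

Fixpoint box_sum (s M : nat) (F : list nat -> R) : R :=
  match s with
  | O => F []
  | S s' => fsum M (fun i => box_sum s' M (fun k => F (i :: k)))
  end.

Definition r_ag (alpha gamma : R) (h : nat) : R :=
  match h with O => 1 | S _ => gamma * Rpower (INR h) (-2 * alpha) end.

Fixpoint r_w (alpha : R) (gamma : list R) (k : list nat) : R :=
  match gamma, k with
  | g :: gamma', h :: k' => r_ag alpha g h * r_w alpha gamma' k'
  | _, _ => 1
  end.

Definition phi (h : nat) (t : R) : R :=
  match h with O => 1 | S _ => sqrt 2 * cos (PI * INR h * t) end.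

Fixpoint psi (k : list nat) (x : list R) : R :=
  match k, x with
  | h :: k', t :: x' => phi h t * psi k' x'
  | _, _ => 1
  end.

Definition in_cube (s : nat) (x : list R) : Prop :=
  length x = s /\ Forall (fun t => 0 <= t <= 1) x.

Fixpoint cube_integral (s : nat) (g : list R -> R) (I : R) : Prop :=
  match s with
  | O => I = g []
  | S s' => exists h : R -> R,
      (forall t, 0 <= t <= 1 -> cube_integral s' (fun y => g (t :: y)) (h t)) /\
      exists pr : Riemann_integrable h 0 1, RiemannInt pr = I
  end.

(* f belongs to the unit ball of H(K^cos_{alpha,gamma,s}), s = length gamma:
   f = sum_k a_k psi_k on [0,1]^s with ||f||^2 = sum_k a_k^2 / r(k) <= 1 *)
Definition in_unit_ball (alpha : R) (gamma : list R) (f : list R -> R) : Prop :=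
  let s := length gamma in
  exists a : list nat -> R,
    (forall M, box_sum s M (fun k => (a k)^2 / r_w alpha gamma k) <= 1) /\
    (forall x, in_cube s x ->
       Un_cv (fun M => box_sum s M (fun k => a k * psi k x)) (f x)).

Definition quad (N : nat) (P : nat -> list R) (w : nat -> R) (f : list R -> R) : R :=
  fsum N (fun n => w n * f (P n)).

(* B is an upper bound for the set whose supremum is e(H; P; w) *)
Definition wce_upper_bound (alpha : R) (gamma : list R) (N : nat)
    (P : nat -> list R) (w : nat -> R) (B : R) : Prop :=
  forall f, in_unit_ball alpha gamma f ->
    forall I, cube_integral (length gamma) f I ->
      Rabs (I - quad N P w f) <= B.

(* Main.v *)
(** Choose [n] with [2N <= 2^n <= 4N].  For every [m] in [nat^s] with [|m| = n], the cosine
    polynomials with frequencies below [2^m] form a space of dimension [2^n >= 2N], so those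
    vanishing at the nodes form a subspace of dimension at least [2^n / 2].  The diagonal of
    the reproducing kernel of that subspace, divided by [2^n], is a cosine polynomial [g_m]
    with values in [[0, 2^s]] which vanishes at the nodes and has integral at least [1/2].
    The fooling function is [f = sum_m g_m].  Its integral is at least half the number
    [#A ~ n^(s-1)] of admissible [m].  By Cauchy-Schwarz, the squared norm of [f] is at most
    the sum over [m] and [k] of [a_(m,k)^2 c_k / r(k)], where [c_k] counts the [m] whose
    frequency range contains [k]; geometric sums give [c_k / r(k) <= C 2^(2 alpha n)], and
    Bessel's inequality bounds the sum over [k] of [a_(m,k)^2] by [4^s].  Hence the error is
    at least a
    constant times [#A / sqrt (2^(2 alpha n) #A)], which is of order
    [n^((s-1)/2) 2^(- alpha n)]. *)

From Coquelicot Require Import Coquelicot.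
Require Import Defs.
From Stdlib Require Import Reals List Lra Lia.
From Stdlib Require Import FunctionalExtensionality IndefiniteDescription.
Import ListNotations.
Open Scope R_scope.

(** * Finite sums indexed by lists *)

Definition lsum {A : Type} (l : list A) (f : A -> R) : R :=
  fold_right (fun i acc => f i + acc) 0 l.

Lemma lsum_ext {A : Type} (l : list A) (f g : A -> R) :
  (forall i, In i l -> f i = g i) -> lsum l f = lsum l g.
Proof.
  induction l as [|i l IH]; intros H; simpl; [reflexivity|].
  rewrite (H i (or_introl eq_refl)), IH; [reflexivity|].
  intros j Hj; apply H; now right.
Qed.

Lemma lsum_add {A : Type} (l : list A) (f g : A -> R) :
  lsum l (fun i => f i + g i) = lsum l f + lsum l g.
Proof. induction l as [|i l IH]; simpl; [|rewrite IH]; ring. Qed.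

Lemma lsum_scal {A : Type} (l : list A) (c : R) (f : A -> R) :
  lsum l (fun i => c * f i) = c * lsum l f.
Proof. induction l as [|i l IH]; simpl; [|rewrite IH]; ring. Qed.

Lemma lsum_scal_r {A : Type} (l : list A) (c : R) (f : A -> R) :
  lsum l (fun i => f i * c) = lsum l f * c.
Proof. induction l as [|i l IH]; simpl; [|rewrite IH]; ring. Qed.

Lemma lsum_const {A : Type} (l : list A) (c : R) :
  lsum l (fun _ => c) = INR (length l) * c.
Proof.
  induction l as [|i l IH]; [simpl; ring|].
  cbn [length lsum fold_right]. fold (lsum l (fun _ => c)). rewrite IH, S_INR. ring.
Qed.

Lemma lsum_le {A : Type} (l : list A) (f g : A -> R) :
  (forall i, In i l -> f i <= g i) -> lsum l f <= lsum l g.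
Proof.
  induction l as [|i l IH]; intros H; simpl; [lra|].
  pose proof (H i (or_introl eq_refl)).
  assert (lsum l f <= lsum l g) by (apply IH; intros j Hj; apply H; now right).
  lra.
Qed.

Lemma lsum_nonneg {A : Type} (l : list A) (f : A -> R) :
  (forall i, In i l -> 0 <= f i) -> 0 <= lsum l f.
Proof.
  intros H. apply Rle_trans with (lsum l (fun _ => 0)).
  - rewrite lsum_const; lra.
  - now apply lsum_le.
Qed.

Lemma lsum_app {A : Type} (l l' : list A) (f : A -> R) :
  lsum (l ++ l') f = lsum l f + lsum l' f.
Proof. induction l as [|i l IH]; simpl; [|rewrite IH]; ring. Qed.

Lemma lsum_map {A B : Type} (h : A -> B) (l : list A) (f : B -> R) :
  lsum (map h l) f = lsum l (fun i => f (h i)).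
Proof. induction l as [|i l IH]; simpl; [|rewrite IH]; reflexivity. Qed.

Lemma lsum_flat_map {A B : Type} (h : A -> list B) (l : list A) (f : B -> R) :
  lsum (flat_map h l) f = lsum l (fun i => lsum (h i) f).
Proof. induction l as [|i l IH]; simpl; [|rewrite lsum_app, IH]; reflexivity. Qed.

Lemma lsum_swap {A B : Type} (l : list A) (l' : list B) (f : A -> B -> R) :
  lsum l (fun i => lsum l' (fun j => f i j))
  = lsum l' (fun j => lsum l (fun i => f i j)).
Proof.
  induction l as [|i l IH]; simpl.
  - rewrite lsum_const; ring.
  - now rewrite IH, lsum_add.
Qed.

Lemma lsum_mul {A : Type} (l : list A) (f g : A -> R) :
  lsum l f * lsum l g = lsum l (fun i => lsum l (fun j => f i * g j)).
Proof.
  rewrite <- lsum_scal_r. apply lsum_ext; intros i _. now rewrite lsum_scal.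
Qed.

(** Each element of [l] is matched with one occurrence in [l'], which is then deleted; the entries
    of [l'] left over contribute nonnegative terms. *)
Lemma lsum_incl_le {A : Type} (l l' : list A) (f : A -> R) :
  NoDup l -> incl l l' -> (forall i, In i l' -> 0 <= f i) ->
  lsum l f <= lsum l' f.
Proof.
  revert l'; induction l as [|i l IH]; intros l' Hnd Hincl Hpos.
  - now apply lsum_nonneg.
  - destruct (in_split i l') as [l1 [l2 ->]]; [apply Hincl; now left|].
    inversion_clear Hnd as [|? ? Hi Hl].
    assert (lsum l f <= lsum (l1 ++ l2) f).
    { apply IH; auto.
      - intros j Hj. destruct (in_app_or _ _ _ (Hincl j (or_intror Hj))) as [H|[<-|H]].
        + apply in_or_app; now left.
        + contradiction.
        + apply in_or_app; now right.
      - intros j Hj. apply Hpos. apply in_app_or in Hj. apply in_or_app.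
        destruct Hj; [now left|right; now right]. }
    rewrite lsum_app in *. simpl. lra.
Qed.

Lemma lsum_square_nonneg {A : Type} (l : list A) (f : A -> R) :
  0 <= lsum l (fun i => f i * f i).
Proof. apply lsum_nonneg; intros; apply Rle_0_sqr. Qed.

Lemma lsum_cauchy_schwarz {A : Type} (l : list A) (f g : A -> R) :
  (lsum l (fun i => f i * g i)) ^ 2
  <= lsum l (fun i => f i ^ 2) * lsum l (fun i => g i ^ 2).
Proof.
  induction l as [|i l IH]; [simpl; lra|].
  cbn [lsum fold_right].
  fold (lsum l (fun i => f i * g i)) (lsum l (fun i => f i ^ 2)) (lsum l (fun i => g i ^ 2)).
  assert (Hp : 0 <= lsum l (fun i => f i ^ 2)) by (apply lsum_nonneg; intros; apply pow2_ge_0).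
  assert (Hq : 0 <= lsum l (fun i => g i ^ 2)) by (apply lsum_nonneg; intros; apply pow2_ge_0).
  set (p := lsum l (fun i => f i ^ 2)) in *.
  set (q := lsum l (fun i => g i ^ 2)) in *.
  set (c := lsum l (fun i => f i * g i)) in *.
  set (x := f i). set (y := g i).
  (* This bounds the cross term: the induction hypothesis gives [(2 c x y)^2 <= 4 p q x^2 y^2],
     which is at most [(x^2 q + y^2 p)^2] by the inequality of arithmetic and geometric means. *)
  assert (Hc : 2 * (c * (x * y)) <= x ^ 2 * q + y ^ 2 * p).
  { apply Rle_trans with (2 * Rabs (c * (x * y))); [pose proof (Rle_abs (c * (x * y))); lra|].
    apply Rsqr_incr_0_var.
    - assert (Hs : Rsqr (2 * Rabs (c * (x * y))) = 4 * (c ^ 2 * (x ^ 2 * y ^ 2))).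
      { unfold Rsqr. replace (2 * Rabs (c * (x * y)) * (2 * Rabs (c * (x * y))))
          with (4 * (Rabs (c * (x * y)) * Rabs (c * (x * y)))) by ring.
        rewrite <- Rabs_mult, Rabs_pos_eq by apply Rle_0_sqr. ring. }
      rewrite Hs. unfold Rsqr.
      assert (c ^ 2 * (x ^ 2 * y ^ 2) <= p * q * (x ^ 2 * y ^ 2)).
      { apply Rmult_le_compat_r; [|exact IH].
        apply Rmult_le_pos; apply pow2_ge_0. }
      pose proof (pow2_ge_0 (x ^ 2 * q - y ^ 2 * p)). nra.
    - apply Rplus_le_le_0_compat; apply Rmult_le_pos; auto; apply pow2_ge_0. }
  nra.
Qed.

(** * Gram-Schmidt *)

Section GramSchmidt.
Context {A : Type} (T : list A).

Definition ip (u v : A -> R) : R := lsum T (fun i => u i * v i).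

Lemma ip_comm u v : ip u v = ip v u.
Proof. apply lsum_ext; intros; ring. Qed.

Lemma ip_add_scal u v c w :
  ip u (fun i => v i + c * w i) = ip u v + c * ip u w.
Proof.
  unfold ip. rewrite <- lsum_scal, <- lsum_add. apply lsum_ext; intros; ring.
Qed.

Lemma ip_scal u c w : ip u (fun i => c * w i) = c * ip u w.
Proof. unfold ip. rewrite <- lsum_scal. apply lsum_ext; intros; ring. Qed.

Fixpoint orthonormal (us : list (A -> R)) : Prop :=
  match us with
  | [] => True
  | u :: us' => ip u u = 1 /\ (forall u', In u' us' -> ip u u' = 0) /\ orthonormal us'
  end.

Lemma ip_remove_component u us v :
  (forall u', In u' us -> ip u u' = 0) ->
  lsum us (fun u' => (ip u' (fun i => v i + - ip u v * u i)) ^ 2)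
  = lsum us (fun u' => (ip u' v) ^ 2).
Proof.
  intros H. apply lsum_ext; intros u' Hu'.
  rewrite ip_add_scal, (ip_comm u' u), (H u' Hu'). f_equal; ring.
Qed.

Lemma ip_remove_component_self u v :
  ip u u = 1 ->
  ip (fun i => v i + - ip u v * u i) (fun i => v i + - ip u v * u i)
  = ip v v - ip u v ^ 2.
Proof.
  intros H. rewrite ip_add_scal, (ip_comm _ v), (ip_comm _ u), !ip_add_scal, H,
    (ip_comm v u). ring.
Qed.

(** Removing from [v] its component along [u] lowers the squared norm by [ip u v ^ 2] and leaves the
    coefficients along the other vectors unchanged, so the induction hypothesis applies to the
    remainder. *)
Lemma bessel us v :
  orthonormal us -> lsum us (fun u => (ip u v) ^ 2) <= ip v v.
Proof.
  revert v; induction us as [|u us IH]; intros v; simpl.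
  - intros _. apply lsum_square_nonneg.
  - intros [Hu [Hperp Hon]].
    pose proof (IH (fun i => v i + - ip u v * u i) Hon) as H.
    rewrite (ip_remove_component u us v Hperp), (ip_remove_component_self u v Hu) in H.
    fold (lsum us (fun u => ip u v * (ip u v * 1))). simpl in H. lra.
Qed.

(** The witness [w] is [v] minus its projection onto the span of [us]. The second clause expresses
    without coefficients that [w] and [v] differ by an element of that span. *)
Lemma orthogonal_residual us v :
  orthonormal us ->
  exists w,
    (forall u, In u us -> ip u w = 0) /\
    (forall p, (forall u, In u us -> ip u p = 0) -> ip p w = ip p v) /\
    ip w w = ip v v - lsum us (fun u => (ip u v) ^ 2).
Proof.
  revert v; induction us as [|u us IH]; intros v.
  - intros _. exists v. split; [|split]; simpl; [easy|easy|ring].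
  - intros [Hu [Hperp Hon]].
    destruct (IH (fun i => v i + - ip u v * u i) Hon) as [w [H1 [H2 H3]]].
    rewrite (ip_remove_component u us v Hperp), (ip_remove_component_self u v Hu) in H3.
    exists w. split; [|split].
    + intros u' [<-|Hu']; [|auto].
      rewrite H2.
      * rewrite ip_add_scal, Hu; ring.
      * intros u' Hu'. rewrite ip_comm; auto.
    + intros p Hp. rewrite H2.
      * rewrite ip_add_scal, (ip_comm p u), (Hp u (or_introl eq_refl)). ring.
      * intros u' Hu'. apply Hp; now right.
    + cbn [lsum fold_right]. fold (lsum us (fun u => ip u v ^ 2)). lra.
Qed.

(** Equality in Bessel's inequality serves as a coefficient-free way to say that [v] lies in the
    span of [us]. In this form it later yields the vanishing of the fooling functions at the
    nodes. *)
Lemma gram_schmidt (vs : list (A -> R)) :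
  exists us, (length us <= length vs)%nat /\ orthonormal us /\
    forall v, In v vs -> lsum us (fun u => (ip u v) ^ 2) = ip v v.
Proof.
  induction vs as [|v vs [us [Hlen [Hon Hspan]]]].
  - exists []. simpl. easy.
  - destruct (orthogonal_residual us v Hon) as [w [H1 [H2 H3]]].
    assert (Hwv : ip w w = ip w v) by (apply H2; exact H1).
    (* A residual of norm zero means that [v] is already in the span and [us] is kept; otherwise the
       normalised residual joins the family. *)
    destruct (Req_dec (ip w w) 0) as [H0|H0].
    + exists us. split; [simpl; lia|]. split; [exact Hon|].
      intros v' [<-|Hv']; [lra|auto].
    + assert (Hpos : 0 < ip w w).
      { pose proof (lsum_square_nonneg T w). unfold ip in *. lra. }
      assert (Hs : sqrt (ip w w) <> 0) by (apply Rgt_not_eq, sqrt_lt_R0, Hpos).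
      assert (Hsq : sqrt (ip w w) * sqrt (ip w w) = ip w w) by (apply sqrt_sqrt; lra).
      set (c := / sqrt (ip w w)).
      assert (Hc : c * c * ip w w = 1).
      { unfold c. rewrite <- Hsq at 3. field. exact Hs. }
      set (u := fun i => c * w i).
      assert (Hon' : orthonormal (u :: us)).
      { simpl. split; [|split; [|exact Hon]].
        - unfold u. rewrite ip_scal, ip_comm, ip_scal. lra.
        - intros u' Hu'. unfold u. rewrite ip_comm, ip_scal, (H1 u' Hu'). ring. }
      exists (u :: us). split; [simpl; lia|]. split; [exact Hon'|].
      intros v' [<-|Hv'].
      * cbn [lsum fold_right]. fold (lsum us (fun u => ip u v ^ 2)).
        unfold u. rewrite (ip_comm _ v), ip_scal, (ip_comm v w), <- Hwv.
        replace ((c * ip w w) ^ 2) with (c * c * ip w w * ip w w) by ring.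
        rewrite Hc. lra.
      * apply Rle_antisym; [now apply bessel|].
        rewrite <- (Hspan v' Hv'). cbn [lsum fold_right].
        fold (lsum us (fun u => ip u v' ^ 2)).
        pose proof (pow2_ge_0 (ip u v')). lra.
Qed.

Lemma orthonormal_norm us u : orthonormal us -> In u us -> ip u u = 1.
Proof.
  induction us as [|u' us IH]; [easy|].
  intros [H [_ Hon]] [<-|Hu]; auto.
Qed.

End GramSchmidt.

(** * Boxes of multi-indices *)

Fixpoint box (b : list nat) : list (list nat) :=
  match b with
  | [] => [[]]
  | n :: b' => flat_map (fun i => map (cons i) (box b')) (seq 0 n)
  end.

Lemma lsum_box_cons n b (F : list nat -> R) :
  lsum (box (n :: b)) F = lsum (seq 0 n) (fun i => lsum (box b) (fun k => F (i :: k))).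
Proof.
  simpl. rewrite lsum_flat_map. apply lsum_ext; intros i _. apply lsum_map.
Qed.

Lemma in_box b k : In k (box b) <-> Forall2 lt k b.
Proof.
  revert k; induction b as [|n b IH]; intros k; simpl.
  - split; [intros [<-|[]]; constructor|].
    intros H; inversion H; now left.
  - rewrite in_flat_map. split.
    + intros [i [Hi Hk]]. apply in_map_iff in Hk as [k' [<- Hk']].
      apply in_seq in Hi. constructor; [lia|now apply IH].
    + intros H; inversion_clear H. exists x. split; [apply in_seq; lia|].
      apply in_map, IH; assumption.
Qed.

Lemma nodup_box b : NoDup (box b).
Proof.
  induction b as [|n b IH]; simpl; [repeat constructor; easy|].
  generalize (seq_NoDup n 0). induction (seq 0 n) as [|i l IHl]; intros Hnd; simpl.
  - constructor.
  - inversion_clear Hnd. apply NoDup_app.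
    + apply NoDup_map_NoDup_ForallPairs; [|exact IH]. intros x y _ _ E; now injection E.
    + auto.
    + intros k Hk Hk'. apply in_map_iff in Hk as [k1 [<- _]].
      apply in_flat_map in Hk' as [j [Hj Hk']].
      apply in_map_iff in Hk' as [k2 [E _]]. injection E as -> _. contradiction.
Qed.

Lemma length_box b : length (box b) = fold_right Nat.mul 1%nat b.
Proof.
  induction b as [|n b IH]; simpl; [reflexivity|].
  rewrite <- IH. transitivity (length (seq 0 n) * length (box b))%nat.
  - induction (seq 0 n) as [|i l IHl]; simpl; [reflexivity|].
    now rewrite length_app, length_map, IHl.
  - now rewrite length_seq.
Qed.

Lemma Forall2_length_eq {A B : Type} (r : A -> B -> Prop) l l' :
  Forall2 r l l' -> length l = length l'.
Proof. induction 1; simpl; congruence. Qed.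

Lemma fsum_lsum M (g : nat -> R) : fsum M g = lsum (seq 0 M) g.
Proof.
  induction M as [|M IH]; [reflexivity|].
  rewrite seq_S, lsum_app, <- IH. simpl. ring.
Qed.

Lemma box_sum_lsum s M (F : list nat -> R) :
  box_sum s M F = lsum (box (repeat M s)) F.
Proof.
  revert F; induction s as [|s IH]; intros F.
  - simpl. ring.
  - cbn [repeat]. rewrite lsum_box_cons. cbn [box_sum]. rewrite fsum_lsum.
    apply lsum_ext; intros i _. apply IH.
Qed.

Lemma in_box_repeat s M k :
  In k (box (repeat M s)) <-> length k = s /\ Forall (fun i => (i < M)%nat) k.
Proof.
  rewrite in_box. revert k; induction s as [|s IH]; intros k; simpl.
  - split; [intros H; inversion H; now split|].
    intros [H _]. destruct k; [constructor|discriminate].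
  - split.
    + intros H; inversion_clear H. apply IH in H1 as [H1 H2].
      simpl; split; [congruence|now constructor].
    + intros [H1 H2]. destruct k as [|i k]; [discriminate|].
      inversion_clear H2. constructor; [assumption|]. apply IH. split; [|assumption].
      simpl in H1; congruence.
Qed.

Lemma lsum_box_repeat_mono s M M' (F : list nat -> R) :
  (M <= M')%nat -> (forall k, 0 <= F k) ->
  lsum (box (repeat M s)) F <= lsum (box (repeat M' s)) F.
Proof.
  intros HM HF. apply lsum_incl_le; [apply nodup_box| |auto].
  intros k Hk. apply in_box_repeat in Hk as [H1 H2]. apply in_box_repeat.
  split; [assumption|]. revert H2; apply Forall_impl; intros; lia.
Qed.

Definition delta {A : Type} (dec : forall x y : A, {x = y} + {x <> y}) (i j : A) : R :=
  if dec i j then 1 else 0.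

Lemma lsum_delta {A : Type} dec (l : list A) i (F : A -> R) :
  NoDup l -> In i l -> lsum l (fun j => F j * delta dec i j) = F i.
Proof.
  intros Hnd. induction l as [|j l IH]; [easy|].
  inversion_clear Hnd as [|? ? Hj Hl]. intros [->|Hi]; simpl; unfold delta at 1.
  - destruct (dec i i) as [_|]; [|contradiction].
    rewrite (lsum_ext l _ (fun _ => 0)); [rewrite lsum_const; ring|].
    intros j' Hj'. unfold delta. destruct (dec i j') as [->|]; [contradiction|ring].
  - destruct (dec i j) as [->|_]; [contradiction|]. rewrite IH by assumption. ring.
Qed.

Notation deltal := (delta (list_eq_dec Nat.eq_dec)).

Lemma deltal_cons i j k k' :
  deltal (i :: k) (j :: k') = delta Nat.eq_dec i j * deltal k k'.
Proof.
  unfold delta.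
  destruct (list_eq_dec Nat.eq_dec (i :: k) (j :: k')) as [E|E],
    (Nat.eq_dec i j) as [E1|E1], (list_eq_dec Nat.eq_dec k k') as [E2|E2];
    try ring; try (injection E as ? ?; contradiction).
  exfalso; apply E; congruence.
Qed.

(** * Cosine polynomials *)

(* The expansion is required over every cubic box containing [b], so that polynomials
   with different [b] can be added. *)
Definition cospoly (b : list nat) (F : list R -> R) (a : list nat -> R) : Prop :=
  (forall k, length k = length b -> a k <> 0 -> Forall2 lt k b) /\
  forall x M, length x = length b -> Forall (fun n => (n <= M)%nat) b ->
    F x = lsum (box (repeat M (length b))) (fun k => a k * psi k x).

(* [e], the coefficient at frequency 0, is the integral of [F]. *)
Definition has_cospoly (b : list nat) (F : list R -> R) (e : R) : Prop :=
  exists a, cospoly b F a /\ a (repeat O (length b)) = e.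

Lemma cospoly_zero b : cospoly b (fun _ => 0) (fun _ => 0).
Proof.
  split; [intros; contradiction|].
  intros. rewrite (lsum_ext _ _ (fun _ => 0)); [rewrite lsum_const|intros]; ring.
Qed.

Lemma cospoly_add_scal b F a c F' a' :
  cospoly b F a -> cospoly b F' a' ->
  cospoly b (fun x => F x + c * F' x) (fun k => a k + c * a' k).
Proof.
  intros [H1 H2] [H1' H2']. split.
  - intros k Hk Hne. destruct (Req_dec (a k) 0) as [E|E]; [|now apply H1].
    apply H1'; [assumption|]. intros E'. apply Hne. rewrite E, E'. ring.
  - intros x M Hx HM. rewrite (H2 x M Hx HM), (H2' x M Hx HM), <- lsum_scal, <- lsum_add.
    apply lsum_ext; intros; ring.
Qed.

Lemma cospoly_ext b F F' a :
  cospoly b F a -> (forall x, length x = length b -> F' x = F x) -> cospoly b F' a.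
Proof.
  intros [H1 H2] H. split; [assumption|]. intros. rewrite H by assumption. auto.
Qed.

Lemma has_cospoly_ext b F F' e :
  has_cospoly b F e -> (forall x, length x = length b -> F' x = F x) -> has_cospoly b F' e.
Proof. intros [a [H He]] E. exists a. split; [|assumption]. now apply cospoly_ext with F. Qed.

Lemma has_cospoly_add_scal b F e c F' e' :
  has_cospoly b F e -> has_cospoly b F' e' ->
  has_cospoly b (fun x => F x + c * F' x) (e + c * e').
Proof.
  intros [a [H <-]] [a' [H' <-]]. exists (fun k => a k + c * a' k).
  split; [now apply cospoly_add_scal|reflexivity].
Qed.

Lemma has_cospoly_zero b : has_cospoly b (fun _ => 0) 0.
Proof. exists (fun _ => 0). split; [apply cospoly_zero|reflexivity]. Qed.

Lemma has_cospoly_lsum {A : Type} b (l : list A) (F : A -> list R -> R) (c e : A -> R) :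
  (forall i, In i l -> has_cospoly b (F i) (e i)) ->
  has_cospoly b (fun x => lsum l (fun i => c i * F i x)) (lsum l (fun i => c i * e i)).
Proof.
  induction l as [|i l IH]; intros H; simpl; [apply has_cospoly_zero|].
  rewrite Rplus_comm.
  apply has_cospoly_ext with (fun x => lsum l (fun i => c i * F i x) + c i * F i x).
  - apply has_cospoly_add_scal; [apply IH; intros j Hj|]; apply H; [now right|now left].
  - intros; ring.
Qed.

(* [2 cos A cos B = cos (A + B) + cos (A - B)], the case [h = h'] being special
   because [phi 0] is not normalised by [sqrt 2]. *)
Lemma phi_mul h h' n :
  (h + h' < n)%nat ->
  exists c : nat -> R,
    (forall l, c l <> 0 -> (l < n)%nat) /\ c O = delta Nat.eq_dec h h' /\
    forall t M, (n <= M)%nat ->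
      phi h t * phi h' t = lsum (seq 0 M) (fun l => c l * phi l t).
Proof.
  intros Hn.
  (* Expansion of a single term [v * phi p]; the product [phi h * phi h'] is one such term or a sum
     of two. *)
  assert (Hsingle : forall p v, (p < n)%nat ->
    (forall l, v * delta Nat.eq_dec p l <> 0 -> (l < n)%nat) /\
    forall t M, (n <= M)%nat ->
      lsum (seq 0 M) (fun l => v * delta Nat.eq_dec p l * phi l t) = v * phi p t).
  { intros p v Hp. split.
    - intros l. unfold delta. destruct (Nat.eq_dec p l) as [<-|]; [auto|].
      intros H; contradiction H; ring.
    - intros t M HM.
      rewrite (lsum_ext _ _ (fun l => (v * phi l t) * delta Nat.eq_dec p l)) by (intros; ring).
      rewrite (lsum_delta Nat.eq_dec (seq 0 M) p (fun l => v * phi l t));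
        [reflexivity|apply seq_NoDup|apply in_seq; lia]. }
  destruct (Nat.eq_dec h 0) as [->|Hh].
  { destruct (Hsingle h' 1) as [S1 S2]; [lia|].
    exists (fun l => 1 * delta Nat.eq_dec h' l). split; [exact S1|]. split.
    - unfold delta. destruct (Nat.eq_dec h' 0), (Nat.eq_dec 0 h'); lia || lra.
    - intros t M HM. rewrite S2 by assumption. reflexivity. }
  destruct (Nat.eq_dec h' 0) as [->|Hh'].
  { destruct (Hsingle h 1) as [S1 S2]; [lia|].
    exists (fun l => 1 * delta Nat.eq_dec h l). split; [exact S1|]. split.
    - unfold delta. destruct (Nat.eq_dec h 0); lia || lra.
    - intros t M HM. rewrite S2 by assumption. simpl. ring. }
  assert (H2 : sqrt 2 * sqrt 2 = 2) by (apply sqrt_sqrt; lra).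
  assert (H2n : sqrt 2 <> 0) by (apply Rgt_not_eq, sqrt_lt_R0; lra).
  assert (Hphi : forall l t, l <> O -> phi l t = sqrt 2 * cos (PI * INR l * t)).
  { intros [|l] t H; [contradiction|reflexivity]. }
  (* Subtraction on [nat] is truncated, so [d] is the absolute difference of [h] and [h']. *)
  set (d := ((h - h') + (h' - h))%nat).
  set (v := if Nat.eq_dec h h' then 1 else / sqrt 2).
  destruct (Hsingle (h + h')%nat (/ sqrt 2)) as [S1 S2]; [lia|].
  destruct (Hsingle d v) as [T1 T2]; [unfold d; lia|].
  exists (fun l => / sqrt 2 * delta Nat.eq_dec (h + h')%nat l + v * delta Nat.eq_dec d l).
  split; [|split].
  - intros l Hl. destruct (Req_dec (/ sqrt 2 * delta Nat.eq_dec (h + h')%nat l) 0) as [E|E];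
      [|now apply S1].
    apply T1. lra.
  - unfold v, delta, d. destruct (Nat.eq_dec h h'), (Nat.eq_dec (h + h') 0),
      (Nat.eq_dec (h - h' + (h' - h)) 0); lia || lra.
  - intros t M HM.
    rewrite (lsum_ext _ _ (fun l => / sqrt 2 * delta Nat.eq_dec (h + h')%nat l * phi l t
       + v * delta Nat.eq_dec d l * phi l t)) by (intros; ring).
    rewrite lsum_add, S2, T2 by assumption.
    rewrite !Hphi by lia.
    assert (Hd : v * phi d t = cos (PI * INR h * t - PI * INR h' * t)).
    { unfold v, d. destruct (Nat.eq_dec h h') as [<-|Hne].
      - rewrite Nat.sub_diag. simpl. replace (PI * INR h * t - PI * INR h * t) with 0 by ring.
        rewrite cos_0. ring.
      - rewrite Hphi by lia. rewrite <- Rmult_assoc, Rinv_l, Rmult_1_l by assumption.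
        destruct (Nat.le_gt_cases h h') as [Hle|Hlt].
        + replace (h - h' + (h' - h))%nat with (h' - h)%nat by lia.
          rewrite minus_INR by lia. rewrite <- (cos_neg (_ - _)). f_equal; ring.
        + replace (h - h' + (h' - h))%nat with (h - h')%nat by lia.
          rewrite minus_INR by lia. f_equal; ring. }
    rewrite Hd.
    replace (/ sqrt 2 * (sqrt 2 * cos (PI * INR (h + h') * t)))
      with (cos (PI * INR (h + h') * t)) by (field; assumption).
    rewrite plus_INR, cos_minus.
    replace (PI * (INR h + INR h') * t) with (PI * INR h * t + PI * INR h' * t) by ring.
    rewrite cos_plus.
    replace (sqrt 2 * cos (PI * INR h * t) * (sqrt 2 * cos (PI * INR h' * t)))
      with (sqrt 2 * sqrt 2 * (cos (PI * INR h * t) * cos (PI * INR h' * t))) by ring.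
    rewrite H2. ring.
Qed.

(** The coefficients are products of those from [phi_mul] in the separate coordinates. The value
    [deltal k k'] of the mean is the orthonormality of the functions [psi k]. *)
Lemma has_cospoly_psi_mul b k k' :
  Forall2 (fun p n => (fst p + snd p < n)%nat) (combine k k') b ->
  length k = length b -> length k' = length b ->
  has_cospoly b (fun x => psi k x * psi k' x) (deltal k k').
Proof.
  revert k k'; induction b as [|n b IH]; intros k k' H Hk Hk'.
  - destruct k, k'; try discriminate. exists (fun _ => 1). split; [split|].
    + intros [|? ?] E _; [constructor|discriminate].
    + intros x M Hx _. destruct x; [|discriminate]. simpl. ring.
    + unfold delta. now destruct (list_eq_dec Nat.eq_dec [] []).
  - destruct k as [|h k]; [discriminate|]. destruct k' as [|h' k']; [discriminate|].
    inversion_clear H as [|? ? ? ? Hn Hb]. simpl in Hn.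
    destruct (phi_mul h h' n Hn) as [c [C1 [C2 C3]]].
    destruct (IH k k' Hb) as [a [[A1 A2] A3]]; [simpl in *; congruence..|].
    exists (fun l => match l with [] => 0 | i :: l' => c i * a l' end).
    split; [split|].
    + intros [|i l] Hl Hne; [discriminate|].
      constructor.
      * apply C1. intros E; apply Hne; rewrite E; ring.
      * apply A1; [simpl in Hl; congruence|]. intros E; apply Hne; rewrite E; ring.
    + intros [|t x] M Hx HM; [discriminate|].
      inversion_clear HM as [|? ? HMn HMb].
      cbn [length repeat]. rewrite lsum_box_cons.
      rewrite (lsum_ext _ _ (fun i => c i * phi i t * (psi k x * psi k' x))).
      * rewrite lsum_scal_r, <- C3 by assumption. simpl. ring.
      * intros i _. rewrite (A2 x M) by (simpl in Hx; congruence || assumption).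
        rewrite <- lsum_scal. apply lsum_ext; intros l _. simpl. ring.
    + simpl. rewrite C2, A3, deltal_cons. reflexivity.
Qed.

(** * Integration of cosine polynomials *)

Lemma is_RInt_const_eq a b c v : v = (b - a) * c -> is_RInt (fun _ => c) a b v.
Proof. intros ->. apply (is_RInt_const a b c). Qed.

Lemma is_RInt_phi h : is_RInt (phi h) 0 1 (delta Nat.eq_dec O h).
Proof.
  destruct h as [|h]; unfold delta;
    [destruct (Nat.eq_dec 0 0) as [_|E]; [|contradiction]
    |destruct (Nat.eq_dec 0 (S h)) as [E|_]; [discriminate|]].
  - apply is_RInt_const_eq; ring.
  - assert (Hh : PI * INR (S h) <> 0).
    { apply Rmult_integral_contrapositive. split; [apply PI_neq0|apply not_0_INR; lia]. }
    assert (Hsin : sin (PI * INR (S h)) = 0).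
    { apply sin_eq_0_1. exists (Z.of_nat (S h)). rewrite <- INR_IZR_INZ. ring. }
    change (phi (S h)) with (fun t => sqrt 2 * cos (PI * INR (S h) * t)).
    set (w := PI * INR (S h)) in *. clearbody w.
    set (H t := sqrt 2 * (sin (w * t) / w)).
    replace 0 with (minus (H 1) (H 0)) at 2.
    + apply (is_RInt_derive H).
      * intros t _. unfold H. auto_derive; [trivial|]. field. exact Hh.
      * intros t _. apply (continuity_pt_filterlim (fun t => sqrt 2 * cos (w * t))).
        apply derivable_continuous_pt, ex_derive_Reals_0. auto_derive. trivial.
    + unfold H, minus, plus, opp; simpl. rewrite Rmult_1_r, Rmult_0_r, sin_0, Hsin.
      field; exact Hh.
Qed.

Lemma is_RInt_lsum {A : Type} (l : list A) (f : A -> R -> R) (v : A -> R) a b :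
  (forall i, In i l -> is_RInt (f i) a b (v i)) ->
  is_RInt (fun t => lsum l (fun i => f i t)) a b (lsum l v).
Proof.
  induction l as [|i l IH]; intros H; simpl.
  - apply is_RInt_const_eq; ring.
  - apply (is_RInt_plus (V := R_NormedModule)); [apply H; now left|].
    apply IH. intros; apply H; now right.
Qed.

Lemma is_RInt_cosine_sum M (e : nat -> R) :
  (0 < M)%nat -> is_RInt (fun t => lsum (seq 0 M) (fun l => e l * phi l t)) 0 1 (e O).
Proof.
  intros HM.
  replace (e O) with (lsum (seq 0 M) (fun l => e l * delta Nat.eq_dec O l)).
  - apply is_RInt_lsum. intros i _.
    apply (is_RInt_scal (V := R_NormedModule) (phi i)). apply is_RInt_phi.
  - apply lsum_delta; [apply seq_NoDup|apply in_seq; lia].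
Qed.

Lemma lsum_box_psi_cons s M (a : list nat -> R) t y :
  lsum (box (repeat M (S s))) (fun k => a k * psi k (t :: y))
  = lsum (box (repeat M s))
      (fun k => lsum (seq 0 M) (fun i => a (i :: k) * phi i t) * psi k y).
Proof.
  cbn [repeat]. rewrite lsum_box_cons, lsum_swap. apply lsum_ext; intros k _.
  rewrite <- lsum_scal_r. apply lsum_ext; intros i _. simpl. ring.
Qed.

(** With the first variable fixed at [t], the sum is again a cosine sum in the other variables,
    whose coefficients are cosine sums in [t]. Each integration in turn retains only the frequency
    0. *)
Lemma cube_integral_box s M (a : list nat -> R) :
  (0 < M)%nat ->
  cube_integral s (fun x => lsum (box (repeat M s)) (fun k => a k * psi k x)) (a (repeat O s)).
Proof.
  intros HM. revert a; induction s as [|s IH]; intros a.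
  - simpl. ring.
  - exists (fun t => lsum (seq 0 M) (fun i => a (i :: repeat O s) * phi i t)). split.
    + intros t _.
      replace (fun y => lsum (box (repeat M (S s))) (fun k => a k * psi k (t :: y))) with
        (fun y => lsum (box (repeat M s))
          (fun k => lsum (seq 0 M) (fun i => a (i :: k) * phi i t) * psi k y))
        by (apply functional_extensionality; intros; symmetry; apply lsum_box_psi_cons).
      apply (IH (fun k => lsum (seq 0 M) (fun i => a (i :: k) * phi i t))).
    + pose proof (is_RInt_cosine_sum M (fun i => a (i :: repeat O s)) HM) as H.
      exists (ex_RInt_Reals_0 _ _ _ (ex_intro _ _ H)).
      rewrite <- RInt_Reals. now apply is_RInt_unique.
Qed.

(** Averaging over the first variable with the others fixed leaves the cosine sum with coefficients
    [a (O :: k)], which is still at most [C], so the induction proceeds one variable at a time. *)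
Lemma mean_le_box s M (a : list nat -> R) C :
  (0 < M)%nat ->
  (forall x, in_cube s x -> lsum (box (repeat M s)) (fun k => a k * psi k x) <= C) ->
  a (repeat O s) <= C.
Proof.
  intros HM. revert a; induction s as [|s IH]; intros a H.
  - specialize (H [] (conj eq_refl (Forall_nil _))). simpl in *. lra.
  - simpl. apply (IH (fun k => a (O :: k))). intros y [Hy1 Hy2].
    set (e i := lsum (box (repeat M s)) (fun k => a (i :: k) * psi k y)).
    change (e O <= C).
    apply (is_RInt_le (fun t => lsum (seq 0 M) (fun l => e l * phi l t)) (fun _ => C) 0 1).
    + lra.
    + now apply is_RInt_cosine_sum.
    + apply is_RInt_const_eq; ring.
    + intros t Ht.
      apply Rle_trans with (lsum (box (repeat M (S s))) (fun k => a k * psi k (t :: y))).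
      * right. cbn [repeat]. rewrite lsum_box_cons. apply lsum_ext; intros i _.
        unfold e. rewrite <- lsum_scal_r. apply lsum_ext; intros k _. simpl. ring.
      * apply H. split; [simpl; congruence|]. constructor; [lra|assumption].
Qed.

Lemma exists_upper_bound (b : list nat) :
  exists M, (0 < M)%nat /\ Forall (fun n => (n <= M)%nat) b.
Proof.
  exists (S (list_max b)). split; [lia|].
  pose proof (proj1 (list_max_le b (list_max b)) (le_n _)) as H.
  revert H; apply Forall_impl; intros; lia.
Qed.

Lemma has_cospoly_mean_le b F e C :
  has_cospoly b F e -> (forall x, in_cube (length b) x -> F x <= C) -> e <= C.
Proof.
  intros [a [[_ H] <-]] HF.
  destruct (exists_upper_bound b) as [M [HM HbM]].
  apply (mean_le_box (length b) M a C HM). intros x Hx.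
  rewrite <- (H x M (proj1 Hx) HbM). auto.
Qed.

(** Two frequencies below [n] add up to at most [2 n - 2], which is below [n'] as soon as
    [2 * n <= S n']. *)
Lemma has_cospoly_psi_mul_box b b' k k' :
  Forall2 (fun n n' => (2 * n <= S n')%nat) b b' -> In k (box b) -> In k' (box b) ->
  has_cospoly b' (fun x => psi k x * psi k' x) (deltal k k').
Proof.
  intros Hb Hk Hk'. apply in_box in Hk, Hk'.
  pose proof (Forall2_length_eq _ _ _ Hb). pose proof (Forall2_length_eq _ _ _ Hk).
  pose proof (Forall2_length_eq _ _ _ Hk').
  apply has_cospoly_psi_mul; [|congruence..].
  clear -Hb Hk Hk'. revert k k' Hk Hk'; induction Hb; intros k k' Hk Hk'.
  - inversion Hk; constructor.
  - inversion Hk; inversion Hk'; subst. simpl. constructor; [simpl; lia|auto].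
Qed.

(** Parseval's identity: after expanding the square, orthonormality leaves only the diagonal terms
    in the mean. The larger range [b'] accommodates the frequencies created by squaring. *)
Lemma has_cospoly_square b b' (u : list nat -> R) :
  Forall2 (fun n n' => (2 * n <= S n')%nat) b b' ->
  has_cospoly b' (fun x => (lsum (box b) (fun k => u k * psi k x)) ^ 2)
    (lsum (box b) (fun k => u k ^ 2)).
Proof.
  intros Hb.
  assert (Hrow : forall k, In k (box b) ->
    has_cospoly b' (fun x => lsum (box b) (fun k' => u k' * (psi k x * psi k' x))) (u k)).
  { intros k Hk.
    replace (u k) with (lsum (box b) (fun k' => u k' * deltal k k'))
      by (apply lsum_delta; [apply nodup_box|assumption]).
    apply has_cospoly_lsum. intros; now apply has_cospoly_psi_mul_box with b. }
  replace (lsum (box b) (fun k => u k ^ 2)) with (lsum (box b) (fun k => u k * u k))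
    by (apply lsum_ext; intros; ring).
  eapply has_cospoly_ext; [apply (has_cospoly_lsum b' (box b) _ u u Hrow)|].
  intros x _. cbn beta. replace (lsum (box b) (fun k => u k * psi k x) ^ 2) with
    (lsum (box b) (fun k => u k * psi k x) * lsum (box b) (fun k => u k * psi k x)) by ring.
  rewrite lsum_mul. apply lsum_ext; intros k _. rewrite <- lsum_scal.
  apply lsum_ext; intros; ring.
Qed.

(** By Parseval's identity, the sum of squared coefficients over a box large enough to carry the
    expansion of [F] is the mean of [F ^ 2]. The side [M'] is chosen to dominate both [M] and the
    entries of [b]. *)
Lemma cospoly_bessel b F a C M :
  cospoly b F a -> (forall x, in_cube (length b) x -> (F x) ^ 2 <= C) ->
  lsum (box (repeat M (length b))) (fun k => a k ^ 2) <= C.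
Proof.
  intros [_ Ha] HF.
  destruct (exists_upper_bound b) as [M0 [HM0 HbM0]].
  set (M' := max M M0).
  apply Rle_trans with (lsum (box (repeat M' (length b))) (fun k => a k ^ 2)).
  - apply lsum_box_repeat_mono; [unfold M'; lia|]. intros; apply pow2_ge_0.
  - apply (has_cospoly_mean_le (repeat (2 * M')%nat (length b))
      (fun x => (lsum (box (repeat M' (length b))) (fun k => a k * psi k x)) ^ 2)).
    + apply has_cospoly_square. clear. generalize (length b); intros s.
      induction s; cbn [repeat]; constructor; lia || assumption.
    + rewrite repeat_length. intros x Hx. rewrite <- Ha; [auto|apply Hx|].
      revert HbM0; apply Forall_impl; unfold M'; intros; lia.
Qed.

(** * Fooling functions *)

Lemma psi_square_le k x : (psi k x) ^ 2 <= 2 ^ length k.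
Proof.
  revert x; induction k as [|h k IH]; intros x; [simpl; lra|].
  destruct x as [|t x].
  - simpl psi. rewrite pow1. apply pow_R1_Rle; lra.
  - cbn [psi length]. rewrite Rpow_mult_distr. change (2 ^ S (length k)) with (2 * 2 ^ length k).
    apply Rmult_le_compat; auto using pow2_ge_0.
    destruct h as [|h]; [simpl; lra|].
    unfold phi. rewrite Rpow_mult_distr, pow2_sqrt by lra.
    pose proof (COS_bound (PI * INR (S h) * t)). nra.
Qed.

Lemma length_box_pow2 m : length (box (map (Nat.pow 2) m)) = (2 ^ list_sum m)%nat.
Proof.
  rewrite length_box. induction m as [|j m IH]; [reflexivity|].
  simpl map. simpl list_sum. cbn [fold_right]. now rewrite IH, Nat.pow_add_r.
Qed.

(* The diagonal [x |-> K(x,x)] of the reproducing kernel of the space of those cosine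
   polynomials with frequencies below [2 ^ m] that vanish at the nodes, divided by
   the dimension [2 ^ |m|]. *)
Lemma fooling_function m N (P : nat -> list R) :
  (2 * N <= 2 ^ list_sum m)%nat ->
  exists (g : list R -> R) (a : list nat -> R),
    cospoly (map (fun j => 2 ^ S j)%nat m) g a /\
    (forall n, (n < N)%nat -> g (P n) = 0) /\
    (forall x, in_cube (length m) x -> 0 <= g x <= 2 ^ length m) /\
    1 / 2 <= a (repeat O (length m)).
Proof.
  intros HN.
  set (b := map (Nat.pow 2) m). set (b' := map (fun j => 2 ^ S j)%nat m).
  assert (Hbb' : Forall2 (fun n n' => (2 * n <= S n')%nat) b b').
  { unfold b, b'. clear. induction m; simpl; constructor; [simpl; lia|assumption]. }
  set (T := box b). set (D := INR (length T)).
  assert (HD : INR N <= D / 2 /\ 0 < D).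
  { unfold D, T, b. rewrite length_box_pow2. apply le_INR in HN. rewrite mult_INR in HN.
    simpl (INR 2) in HN.
    assert (0 < INR (2 ^ list_sum m)); [|lra].
    apply lt_0_INR. pose proof (Nat.pow_nonzero 2 (list_sum m)). lia. }
  destruct HD as [HND HD].
  (* [ev x] represents evaluation at [x]: [ip T u (ev x)] is the value at [x] of the cosine
     polynomial with coefficients [u]. *)
  set (ev x := fun k => psi k x).
  destruct (gram_schmidt T (map (fun n => ev (P n)) (seq 0 N))) as [us [Hlen [Hon Hus]]].
  rewrite length_map, length_seq in Hlen.
  (* [G x] is the squared norm of the component of [ev x] orthogonal to every [ev (P n)], hence zero
     at the nodes. The factors [1] and [-1] fit the linearity lemmas for [has_cospoly]. *)
  set (G x := lsum T (fun k => 1 * (psi k x * psi k x))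
              + -1 * lsum us (fun u => 1 * (lsum T (fun k => u k * psi k x)) ^ 2)).
  assert (HG : forall x, G x = ip T (ev x) (ev x) - lsum us (fun u => ip T u (ev x) ^ 2)).
  { intros x. unfold G. rewrite !lsum_scal. unfold ip, ev. ring. }
  assert (Hcos : has_cospoly b' (fun x => 0 + / D * G x)
     (0 + / D * (lsum T (fun k => 1 * deltal k k)
                + -1 * lsum us (fun u => 1 * lsum T (fun k => u k ^ 2))))).
  { apply has_cospoly_add_scal; [apply has_cospoly_zero|].
    apply has_cospoly_add_scal; apply has_cospoly_lsum.
    - intros k Hk. now apply has_cospoly_psi_mul_box with b.
    - intros u _. now apply has_cospoly_square. }
  destruct Hcos as [a [Ha Ha0]].
  exists (fun x => 0 + / D * G x), a. split; [exact Ha|]. split; [|split].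
  - intros n Hn. rewrite HG, Hus; [ring|].
    apply (in_map (fun n => ev (P n))). apply in_seq; lia.
  (* Bessel's inequality gives [G x >= 0]; dropping the subtracted sum bounds [G x] by a sum of [D]
     squares [psi k x ^ 2], each at most [2 ^ length m]. *)
  - intros x Hx. pose proof (Rinv_0_lt_compat D HD) as HDi.
    pose proof (bessel T us (ev x) Hon) as Hb. pose proof (HG x) as HGx.
    rewrite Rplus_0_l. split; [apply Rmult_le_pos; lra|].
    apply Rle_trans with (/ D * (D * 2 ^ length m)); [|right; field; lra].
    apply Rmult_le_compat_l; [lra|].
    apply Rle_trans with (ip T (ev x) (ev x)).
    + assert (0 <= lsum us (fun u => ip T u (ev x) ^ 2))
        by (apply lsum_nonneg; intros; apply pow2_ge_0). lra.
    + unfold D. rewrite <- lsum_const. apply lsum_le. intros k Hk.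
      unfold ev. replace (length m) with (length k).
      * pose proof (psi_square_le k x). simpl in *. lra.
      * unfold T in Hk. apply in_box, Forall2_length_eq in Hk. rewrite Hk. apply length_map.
  (* Every [psi k] and every polynomial from [us] has mean square 1, so [G] has mean
     [D - length us >= D - N >= D / 2]. *)
  - unfold b' in Ha0. rewrite length_map in Ha0. rewrite Ha0, !lsum_scal.
    rewrite (lsum_ext T _ (fun _ => 1))
      by (intros k _; unfold delta; now destruct (list_eq_dec Nat.eq_dec k k)).
    rewrite (lsum_ext us _ (fun _ => 1)).
    + rewrite !lsum_const. fold D. apply le_INR in Hlen.
      apply Rle_trans with (/ D * (D / 2)); [right; field; lra|].
      rewrite Rplus_0_l. apply Rmult_le_compat_l; [left; now apply Rinv_0_lt_compat|]. lra.
    + intros u Hu. rewrite <- (orthonormal_norm T us u Hon Hu).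
      apply lsum_ext; intros; ring.
Qed.

(** * The norm of a sum of fooling functions *)

(** The exponent [S j] rather than [j] reflects the squaring in the fooling function, which doubles
    the frequency range. Summing the product [covers m k] over [m] gives the count [c_k]. *)
Definition covers1 (j i : nat) : R := if (i <? 2 ^ S j)%nat then 1 else 0.

Fixpoint covers (m k : list nat) : R :=
  match m, k with
  | j :: m', i :: k' => covers1 j i * covers m' k'
  | _, _ => 1
  end.

Lemma covers_nonneg m k : 0 <= covers m k.
Proof.
  revert k; induction m as [|j m IH]; intros [|i k]; simpl; try lra.
  apply Rmult_le_pos; [|apply IH]. unfold covers1. destruct (_ <? _)%nat; lra.
Qed.

Lemma covers_square m k : covers m k ^ 2 = covers m k.
Proof.
  revert k; induction m as [|j m IH]; intros [|i k]; cbn [covers]; try (simpl; lra).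
  rewrite Rpow_mult_distr, IH. unfold covers1. destruct (_ <? _)%nat; simpl; lra.
Qed.

Lemma covers_Forall2 m k :
  Forall2 lt k (map (fun j => 2 ^ S j)%nat m) -> covers m k = 1.
Proof.
  revert k; induction m as [|j m IH]; intros k H; inversion_clear H; [reflexivity|].
  cbn [covers]. rewrite IH by assumption. unfold covers1.
  rewrite (proj2 (Nat.ltb_lt _ _)) by assumption. ring.
Qed.

(* Once the first term [q^m K <= 1/q] is reached, the terms decay geometrically with
   ratio at most 1/2; the strengthened bound makes the induction go through. *)
Lemma truncated_geometric_sum (q K : R) (chi : nat -> R) n :
  0 < q <= 1 / 2 -> 0 <= K ->
  (forall j, chi j = 0 \/ chi j = 1 /\ q ^ S j * K <= 1) ->
  lsum (seq 0 n) (fun j => chi j * q ^ j) * K <= 2 / q.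
Proof.
  intros Hq HK Hchi.
  assert (H : lsum (seq 0 n) (fun j => chi j * q ^ j) = 0 \/
    lsum (seq 0 n) (fun j => chi j * q ^ j) * K <= 2 / q - 2 * (q ^ n * K)).
  { induction n as [|n IH]; [now left|].
    rewrite seq_S, lsum_app, Nat.add_0_l. simpl lsum at 2 4. rewrite Rplus_0_r.
    set (S := lsum (seq 0 n) (fun j => chi j * q ^ j)) in *.
    assert (Hpos : 0 <= q ^ n * K) by (apply Rmult_le_pos; [apply pow_le; lra|assumption]).
    rewrite <- tech_pow_Rmult.
    assert (Hdec : 2 * (q * q ^ n * K) <= q ^ n * K) by nra.
    destruct (Hchi n) as [->|[-> Hn]].
    - destruct IH as [->|IH]; [left; ring|right].
      replace ((S + 0 * q ^ n) * K) with (S * K) by ring. lra.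
    - right. destruct IH as [->|IH].
      + assert (q ^ n * K <= 1 / q).
        { apply Rmult_le_reg_l with q; [lra|]. replace (q * (1 / q)) with 1 by (field; lra).
          rewrite <- tech_pow_Rmult in Hn. lra. }
        replace (2 / q) with (2 * (1 / q)) by (field; lra). lra.
      + replace ((S + 1 * q ^ n) * K) with (S * K + q ^ n * K) by ring. lra. }
  assert (0 < 2 / q) by (apply Rdiv_lt_0_compat; lra).
  assert (0 <= q ^ n * K) by (apply Rmult_le_pos; [apply pow_le; lra|assumption]).
  destruct H as [->|H]; lra.
Qed.

(** The condition [alpha > 1/2] makes the ratio of the geometric sums at most 1/2. *)
Lemma Rpower_2_bounds alpha : 1 / 2 < alpha -> 0 < Rpower 2 (-2 * alpha) <= 1 / 2.
Proof.
  intros Ha. split; [apply exp_pos|].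
  replace (1 / 2) with (Rpower 2 (- (1))).
  - apply Rle_Rpower; lra.
  - rewrite Rpower_Ropp, Rpower_1; lra.
Qed.

Lemma r_ag_pos alpha gamma h : 0 < gamma -> 0 < r_ag alpha gamma h.
Proof.
  intros Hg. destruct h; simpl; [lra|]. apply Rmult_lt_0_compat; [assumption|apply exp_pos].
Qed.

Lemma r_w_pos alpha gamma k : Forall (fun g => 0 < g) gamma -> 0 < r_w alpha gamma k.
Proof.
  revert k; induction gamma as [|g gamma IH]; intros [|h k] H; simpl; try lra.
  inversion_clear H. apply Rmult_lt_0_compat; [now apply r_ag_pos|now apply IH].
Qed.

(** For [h > 0] this is the monotonicity of [h^(-2 alpha)]. The minimum with 1 lets the same bound
    hold at [h = 0], where the weight is 1 instead of a multiple of [gamma]. *)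
Lemma r_ag_ge alpha gamma h j :
  1 / 2 < alpha -> 0 < gamma -> (h < 2 ^ S j)%nat ->
  Rmin gamma 1 * Rpower 2 (-2 * alpha) ^ S j <= r_ag alpha gamma h.
Proof.
  intros Ha Hg Hh. pose proof (Rpower_2_bounds alpha Ha) as [Hq1 Hq2].
  set (q := Rpower 2 (-2 * alpha)) in *.
  assert (Hqj : 0 < q ^ S j) by now apply pow_lt.
  destruct h as [|h].
  - simpl r_ag. assert (q ^ S j <= 1).
    { rewrite <- (pow1 (S j)). apply pow_incr; lra. }
    pose proof (Rmin_r gamma 1). assert (0 < Rmin gamma 1) by (apply Rmin_glb_lt; lra). nra.
  - unfold r_ag. apply Rmult_le_compat; [left; apply Rmin_glb_lt; lra|lra|apply Rmin_l|].
    unfold q. rewrite <- Rpower_pow by apply exp_pos. rewrite Rpower_mult.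
    replace (-2 * alpha * INR (S j)) with (- (INR (S j) * (2 * alpha))) by ring.
    replace (-2 * alpha) with (- (2 * alpha)) by ring.
    rewrite !Rpower_Ropp. apply Rinv_le_contravar; [apply exp_pos|].
    rewrite <- (Rpower_mult 2). apply Rle_Rpower_l; [lra|]. split; [apply lt_0_INR; lia|].
    rewrite Rpower_pow by lra. apply lt_INR in Hh. rewrite pow_INR in Hh.
    simpl (INR 2) in Hh. replace (1 + 1) with 2 in Hh by ring. lra.
Qed.

(** The constant [C] in [c_k / r(k) <= C 2^(2 alpha n)]: one factor per coordinate, consisting of
    the bound [2 / q] of [truncated_geometric_sum] and the loss [Rmin g 1] from [r_ag_ge]. *)
Fixpoint box_const (alpha : R) (gamma : list R) : R :=
  match gamma with
  | [] => 1
  | g :: gamma' =>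
      2 / Rpower 2 (-2 * alpha) / Rmin g 1 * box_const alpha gamma'
  end.

Lemma box_const_pos alpha gamma :
  1 / 2 < alpha -> Forall (fun g => 0 < g) gamma -> 0 < box_const alpha gamma.
Proof.
  intros Ha. pose proof (Rpower_2_bounds alpha Ha).
  induction 1 as [|g gamma Hg _ IH]; simpl; [lra|].
  apply Rmult_lt_0_compat; [|assumption].
  repeat apply Rdiv_lt_0_compat; try lra. apply Rmin_glb_lt; lra.
Qed.

(** Weighting by [q ^ list_sum m] and summing over a full box, instead of over [|m| = n], makes the
    sum factor over the coordinates. Each factor is a truncated geometric sum with
    [K = Rmin g 1 / r_ag alpha g h], whose hypothesis is supplied by [r_ag_ge]. *)
Lemma lsum_covers_le alpha gamma k n :
  1 / 2 < alpha -> Forall (fun g => 0 < g) gamma -> length k = length gamma ->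
  lsum (box (repeat n (length gamma)))
    (fun m => covers m k * Rpower 2 (-2 * alpha) ^ list_sum m) / r_w alpha gamma k
  <= box_const alpha gamma.
Proof.
  intros Ha Hg. pose proof (Rpower_2_bounds alpha Ha) as Hq.
  set (q := Rpower 2 (-2 * alpha)) in *.
  revert k; induction Hg as [|g gamma Hg Hgs IH]; intros k Hk.
  - simpl. destruct k; [|discriminate]. simpl. lra.
  - destruct k as [|h k]; [discriminate|].
    cbn [length repeat]. rewrite lsum_box_cons. cbn [box_const r_w]. fold q.
    rewrite (lsum_ext _ _ (fun j => covers1 j h * q ^ j *
      lsum (box (repeat n (length gamma))) (fun m => covers m k * q ^ list_sum m))).
    + rewrite lsum_scal_r.
      assert (Hr := r_ag_pos alpha g h Hg). assert (Hrw := r_w_pos alpha gamma k Hgs).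
      replace (lsum (seq 0 n) (fun j => covers1 j h * q ^ j) *
         lsum (box (repeat n (length gamma))) (fun m => covers m k * q ^ list_sum m) /
         (r_ag alpha g h * r_w alpha gamma k)) with
        (lsum (seq 0 n) (fun j => covers1 j h * q ^ j) * / r_ag alpha g h *
         (lsum (box (repeat n (length gamma))) (fun m => covers m k * q ^ list_sum m) /
         r_w alpha gamma k)) by (field; lra).
      assert (Hmin : 0 < Rmin g 1) by (apply Rmin_glb_lt; lra).
      apply Rmult_le_compat.
      * apply Rmult_le_pos; [|left; now apply Rinv_0_lt_compat].
        apply lsum_nonneg; intros j _. apply Rmult_le_pos; [|apply pow_le; lra].
        unfold covers1. destruct (_ <? _)%nat; lra.
      * apply Rmult_le_pos; [|left; now apply Rinv_0_lt_compat].
        apply lsum_nonneg; intros m _. apply Rmult_le_pos; [|apply pow_le; lra].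
        apply covers_nonneg.
      * apply Rmult_le_reg_r with (Rmin g 1); [assumption|].
        replace (2 / q / Rmin g 1 * Rmin g 1) with (2 / q) by (field; lra).
        rewrite Rmult_assoc. apply truncated_geometric_sum; [exact Hq| |].
        -- apply Rmult_le_pos; [left; now apply Rinv_0_lt_compat|lra].
        -- intros j. unfold covers1. destruct (Nat.ltb_spec h (2 ^ S j)) as [Hlt|_]; [right|now left].
           split; [reflexivity|].
           pose proof (r_ag_ge alpha g h j Ha Hg Hlt) as Hge. fold q in Hge.
           apply Rmult_le_reg_r with (r_ag alpha g h); [assumption|].
           replace (q ^ S j * (/ r_ag alpha g h * Rmin g 1) * r_ag alpha g h)
             with (Rmin g 1 * q ^ S j) by (field; lra). lra.
      * apply IH. simpl in Hk; congruence.
    + intros j _. rewrite <- lsum_scal. apply lsum_ext; intros m _.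
      cbn [covers]. change (list_sum (j :: m)) with (j + list_sum m)%nat.
      rewrite pow_add. ring.
Qed.

(** At each [k], Cauchy-Schwarz over the indices [m] that cover [k] costs the factor [c_k], and
    [c_k / r(k)] is bounded uniformly in [k]. Exchanging the sums then leaves the [l^2] bound [C]
    for each [m]. *)
Lemma norm_square_le alpha gamma n (A : list (list nat)) (a : list nat -> list nat -> R) M C :
  1 / 2 < alpha -> Forall (fun g => 0 < g) gamma ->
  NoDup A -> (forall m, In m A -> length m = length gamma /\ list_sum m = n) ->
  (forall m k, In m A -> length k = length gamma -> a m k <> 0 -> covers m k = 1) ->
  (forall m, In m A -> lsum (box (repeat M (length gamma))) (fun k => a m k ^ 2) <= C) ->
  lsum (box (repeat M (length gamma)))
    (fun k => lsum A (fun m => a m k) ^ 2 / r_w alpha gamma k)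
  <= box_const alpha gamma / Rpower 2 (-2 * alpha) ^ n * (INR (length A) * C).
Proof.
  intros Ha Hg Hnd HA Hsupp HC. pose proof (Rpower_2_bounds alpha Ha) as Hq.
  set (q := Rpower 2 (-2 * alpha)) in *.
  assert (Hqn : 0 < q ^ n) by (apply pow_lt; lra).
  apply Rle_trans with (lsum (box (repeat M (length gamma)))
    (fun k => box_const alpha gamma / q ^ n * lsum A (fun m => a m k ^ 2))).
  - apply lsum_le. intros k Hk. apply in_box_repeat in Hk as [Hk _].
    assert (Hrw := r_w_pos alpha gamma k Hg).
    assert (Hcs : lsum A (fun m => a m k) ^ 2 <=
      lsum A (fun m => covers m k) * lsum A (fun m => a m k ^ 2)).
    (* The inserted factor [covers m k] is 1 wherever [a m k] is nonzero, and it equals its own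
       square. *)
    { rewrite (lsum_ext A (fun m => a m k) (fun m => covers m k * a m k)).
      - rewrite (lsum_ext A (fun m => covers m k) (fun m => covers m k ^ 2))
          by (intros; now rewrite covers_square).
        apply lsum_cauchy_schwarz.
      - intros m Hm. destruct (Req_dec (a m k) 0) as [->|E]; [ring|].
        rewrite (Hsupp m k Hm Hk E). ring. }
    assert (Hcount : lsum A (fun m => covers m k) * q ^ n / r_w alpha gamma k
                     <= box_const alpha gamma).
    (* Entries of [m] are at most [list_sum m = n], so [A] lies in the box of side [S n]; on [A] the
       weight [q ^ list_sum m] is constantly [q ^ n]. *)
    { apply Rle_trans with (2 := lsum_covers_le alpha gamma k (S n) Ha Hg Hk). fold q.
      apply Rmult_le_compat_r; [left; now apply Rinv_0_lt_compat|].
      rewrite <- lsum_scal_r.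
      rewrite (lsum_ext A _ (fun m => covers m k * q ^ list_sum m))
        by (intros m Hm; now rewrite (proj2 (HA m Hm))).
      apply lsum_incl_le; [assumption| |].
      - intros m Hm. apply in_box_repeat. destruct (HA m Hm) as [H1 H2].
        split; [assumption|]. rewrite <- H2. clear. apply Forall_forall. intros j Hj.
        induction m as [|i m IH]; [easy|].
        change (list_sum (i :: m)) with (i + list_sum m)%nat.
        destruct Hj as [->|Hj]; [lia|]. specialize (IH Hj). lia.
      - intros m _. apply Rmult_le_pos; [apply covers_nonneg|apply pow_le; lra]. }
    assert (0 <= lsum A (fun m => a m k ^ 2)) by (apply lsum_nonneg; intros; apply pow2_ge_0).
    apply Rle_trans with
      (lsum A (fun m => covers m k) * q ^ n / r_w alpha gamma k / q ^ n
       * lsum A (fun m => a m k ^ 2)).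
    + replace (lsum A (fun m => covers m k) * q ^ n / r_w alpha gamma k / q ^ n
       * lsum A (fun m => a m k ^ 2)) with
       (lsum A (fun m => covers m k) * lsum A (fun m => a m k ^ 2) / r_w alpha gamma k)
       by (field; lra).
      apply Rmult_le_compat_r; [left; now apply Rinv_0_lt_compat|exact Hcs].
    + apply Rmult_le_compat_r; [assumption|].
      apply Rmult_le_compat_r; [left; now apply Rinv_0_lt_compat|exact Hcount].
  - rewrite lsum_scal, lsum_swap.
    apply Rmult_le_compat_l.
    + left. apply Rdiv_lt_0_compat; [now apply box_const_pos|assumption].
    + rewrite <- lsum_const. now apply lsum_le.
Qed.

(** * The lower bound *)

(** The last [s - 1] entries range freely over [0, ..., p] with [p] the integer part of [n / s], and
    the first entry completes the sum to [n]. This gives [(p + 1)^(s - 1)] indices, and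
    [p + 1 > n / s]. *)
Lemma exists_diagonal s n :
  (1 <= s)%nat ->
  exists A : list (list nat), NoDup A /\
    (forall m, In m A -> length m = s /\ list_sum m = n) /\
    (INR n / INR s) ^ (s - 1) <= INR (length A).
Proof.
  intros Hs. set (p := (n / s)%nat).
  assert (Hbox : forall m, In m (box (repeat (S p) (s - 1))) ->
    length m = (s - 1)%nat /\ (list_sum m <= n)%nat).
  { intros m Hm. apply in_box_repeat in Hm as [H1 H2]. split; [assumption|].
    assert (list_sum m <= length m * p)%nat.
    { clear H1. induction H2 as [|i m Hi _ IH]; [simpl; lia|].
      change (list_sum (i :: m)) with (i + list_sum m)%nat. simpl. lia. }
    assert (s * p <= n)%nat by (apply Nat.Div0.mul_div_le).
    rewrite H1 in *. nia. }
  exists (map (fun m => (n - list_sum m)%nat :: m) (box (repeat (S p) (s - 1)))).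
  split; [|split].
  - apply NoDup_map_NoDup_ForallPairs; [|apply nodup_box]. intros x y _ _ E; now injection E.
  - intros m Hm. apply in_map_iff in Hm as [m' [<- Hm']].
    destruct (Hbox m' Hm') as [H1 H2]. split; [simpl; lia|].
    change (n - list_sum m' + list_sum m' = n)%nat. lia.
  - rewrite length_map, length_box.
    replace (fold_right Nat.mul 1%nat (repeat (S p) (s - 1))) with (S p ^ (s - 1))%nat.
    + rewrite pow_INR. apply pow_incr.
      assert (0 < INR s) by (apply lt_0_INR; lia).
      split; [apply Rdiv_le_0_compat; [apply pos_INR|assumption]|].
      apply Rmult_le_reg_r with (INR s); [assumption|].
      replace (INR n / INR s * INR s) with (INR n) by (field; lra).
      rewrite <- mult_INR. apply le_INR.
      pose proof (Nat.mul_succ_div_gt n s). unfold p. nia.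
    + generalize (s - 1)%nat; intros t. induction t as [|t IH]; simpl; [reflexivity|].
      now rewrite <- IH.
Qed.

Lemma exists_dyadic N :
  (2 <= N)%nat -> exists n, (2 * N <= 2 ^ n <= 4 * N)%nat.
Proof.
  intros HN. exists (S (S (Nat.log2 N))).
  pose proof (Nat.log2_spec N). simpl in *. lia.
Qed.

(** The test function is [f M0 / sqrt V], which lies in the unit ball because its cosine expansion
    is stationary from [M0] on. It vanishes at the nodes, so its quadrature sum is 0 for every
    choice of weights and its error is its mean. *)
Lemma wce_lower_bound alpha gamma N P w B M0 (a : list nat -> R) V :
  let f := fun M x => lsum (box (repeat M (length gamma))) (fun k => a k * psi k x) in
  wce_upper_bound alpha gamma N P w B ->
  (0 < M0)%nat -> 0 < V ->
  (forall x M, in_cube (length gamma) x -> (M0 <= M)%nat -> f M x = f M0 x) ->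
  (forall n, (n < N)%nat -> f M0 (P n) = 0) ->
  (forall M, lsum (box (repeat M (length gamma)))
               (fun k => a k ^ 2 / r_w alpha gamma k) <= V) ->
  a (repeat O (length gamma)) / sqrt V <= B.
Proof.
  intros f HB HM0 HV Hstable Hzero Hnorm.
  set (s := length gamma) in *. set (c := / sqrt V).
  assert (Hc : c ^ 2 = / V).
  { unfold c. rewrite pow_inv, pow2_sqrt; [reflexivity|lra]. }
  set (F := fun x => lsum (box (repeat M0 s)) (fun k => c * a k * psi k x)).
  assert (HF : forall M x, lsum (box (repeat M s)) (fun k => c * a k * psi k x) = c * f M x).
  { intros M x. unfold f. rewrite <- lsum_scal. apply lsum_ext; intros; ring. }
  assert (Hball : in_unit_ball alpha gamma F).
  { exists (fun k => c * a k). fold s. split.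
    - intros M. rewrite box_sum_lsum.
      rewrite (lsum_ext _ _ (fun k => / V * (a k ^ 2 / r_w alpha gamma k)))
        by (intros k _; rewrite Rpow_mult_distr, Hc; unfold Rdiv; ring).
      rewrite lsum_scal. apply Rmult_le_reg_l with V; [assumption|].
      rewrite <- Rmult_assoc, Rinv_r, Rmult_1_l, Rmult_1_r by lra. apply Hnorm.
    - intros x Hx eps Heps. exists M0. intros M HM.
      rewrite box_sum_lsum. unfold F. rewrite !HF, (Hstable x M Hx HM).
      unfold Rdist. rewrite Rminus_diag, Rabs_R0. assumption. }
  pose proof (HB F Hball _ (cube_integral_box s M0 (fun k => c * a k) HM0)) as H.
  unfold quad in H. rewrite fsum_lsum in H.
  rewrite (lsum_ext _ _ (fun _ => 0)) in H.
  - rewrite lsum_const in H.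
    pose proof (Rle_abs (c * a (repeat O s) - INR (length (seq 0 N)) * 0)).
    unfold Rdiv. fold c. lra.
  - intros n Hn. apply in_seq in Hn. unfold F. rewrite HF, Hzero by lia. ring.
Qed.

Theorem mainTheorem11 (s : nat) (alpha : R) (gamma : list R) :
  (1 <= s)%nat -> 1/2 < alpha -> length gamma = s -> Forall (fun g => 0 < g) gamma ->
  exists C : R, 0 < C /\
    forall (N : nat) (P : nat -> list R) (w : nat -> R),
      (2 <= N)%nat ->
      (forall n, (n < N)%nat -> in_cube s (P n)) ->
      forall B : R, wce_upper_bound alpha gamma N P w B ->
        C * Rpower (ln (INR N)) ((INR s - 1) / 2) / Rpower (INR N) alpha <= B.
Proof.
  intros Hs Ha Hlen Hg.
  pose proof (Rpower_2_bounds alpha Ha) as Hq.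
  pose proof (box_const_pos alpha gamma Ha Hg) as HK.
  set (K := box_const alpha gamma) in *.
  assert (HINRs : 0 < INR s) by (apply lt_0_INR; lia).
  assert (HE : 0 < K * (2 ^ s) ^ 2) by (apply Rmult_lt_0_compat; [|apply pow_lt, pow_lt]; lra).
  (* The first factor combines the mean 1/2 of each fooling function with the norm bound; the second
     comes from the cardinality bound [(n / s)^(s - 1)], the third from [2 ^ n <= 4 N]. *)
  exists (/ (2 * sqrt (K * (2 ^ s) ^ 2)) * Rpower (/ INR s) ((INR s - 1) / 2)
          * Rpower (/ 4) alpha).
  split.
  { repeat apply Rmult_lt_0_compat; try apply exp_pos. apply Rinv_0_lt_compat.
    apply Rmult_lt_0_compat; [lra|now apply sqrt_lt_R0]. }
  intros N P w HN HP B HB.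
  destruct (exists_dyadic N HN) as [n Hn].
  destruct (exists_diagonal s n Hs) as [A [HA1 [HA2 HA3]]].
  (* Outside [A] a dummy pair is supplied, so that the choice of [ga] is a total function of [m]. *)
  assert (Hga : forall m, exists ga : (list R -> R) * (list nat -> R), In m A ->
    cospoly (map (fun j => 2 ^ S j)%nat m) (fst ga) (snd ga) /\
    (forall n, (n < N)%nat -> fst ga (P n) = 0) /\
    (forall x, in_cube s x -> 0 <= fst ga x <= 2 ^ s) /\
    1 / 2 <= snd ga (repeat O s)).
  { intros m. destruct (in_dec (list_eq_dec Nat.eq_dec) m A) as [Hm|Hm].
    - destruct (HA2 m Hm) as [H1 H2].
      destruct (fooling_function m N P) as [g [a Hga]]; [rewrite H2; lia|].
      exists (g, a). rewrite <- H1. intros _. exact Hga.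
    - exists (fun _ => 0, fun _ => 0). intros; contradiction. }
  apply functional_choice in Hga as [ga Hga].
  (* Entries [j] of indices in [A] are at most [n], so [M0] bounds every frequency range
     [2 ^ S j]. *)
  set (a m := snd (ga m)). set (M0 := (2 ^ S n)%nat).
  assert (HM0 : (0 < M0)%nat) by (unfold M0; pose proof (Nat.pow_nonzero 2 (S n)); lia).
  assert (Hle : forall m M, In m A -> (M0 <= M)%nat ->
    Forall (fun i => (i <= M)%nat) (map (fun j => 2 ^ S j)%nat m)).
  { intros m M Hm HM. destruct (HA2 m Hm) as [_ H2]. apply Forall_forall.
    intros i Hi. apply in_map_iff in Hi as [j [<- Hj]].
    apply Nat.le_trans with (2 := HM). apply Nat.pow_le_mono_r; [lia|].
    apply le_n_S. rewrite <- H2. clear -Hj.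
    induction m as [|i m IH]; [easy|].
    change (list_sum (i :: m)) with (i + list_sum m)%nat.
    destruct Hj as [->|Hj]; [lia|]. specialize (IH Hj). lia. }
  assert (Hrep : forall x M, in_cube s x -> (M0 <= M)%nat ->
    lsum (box (repeat M s)) (fun k => lsum A (fun m => a m k) * psi k x)
    = lsum A (fun m => fst (ga m) x)).
  { intros x M Hx HM.
    rewrite (lsum_ext _ _ (fun k => lsum A (fun m => a m k * psi k x)))
      by (intros; now rewrite lsum_scal_r).
    rewrite lsum_swap. apply lsum_ext. intros m Hm.
    destruct (Hga m Hm) as [[_ H] _]. destruct (HA2 m Hm) as [Hm' _].
    rewrite (H x M); rewrite ?length_map, ?Hm'; [reflexivity|apply Hx|now apply Hle]. }
  set (q := Rpower 2 (-2 * alpha)) in *.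
  assert (Hqn : 0 < q ^ n) by (apply pow_lt; lra).
  assert (HA0 : 0 < INR (length A)).
  { apply Rlt_le_trans with (2 := HA3). apply pow_lt, Rdiv_lt_0_compat; [|assumption].
    apply lt_0_INR. destruct n; simpl in Hn; lia. }
  (* This is the bound of [norm_square_le] with [C = (2 ^ s) ^ 2], the square of the uniform bound
     on the fooling functions. *)
  set (V := K / q ^ n * (INR (length A) * (2 ^ s) ^ 2)).
  assert (HV : V = K * (2 ^ s) ^ 2 * (INR (length A) / q ^ n)) by (unfold V; field; lra).
  assert (HV0 : 0 < V).
  { rewrite HV. apply Rmult_lt_0_compat; [assumption|now apply Rdiv_lt_0_compat]. }
  assert (Hmain : lsum A (fun m => a m (repeat O s)) / sqrt V <= B).
  { subst s.
    apply (wce_lower_bound alpha gamma N P w B M0 (fun k => lsum A (fun m => a m k)) V HB HM0 HV0).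
    - intros x M Hx HM. now rewrite !Hrep by (assumption || lia).
    - intros i Hi. rewrite Hrep by (auto || lia).
      rewrite (lsum_ext _ _ (fun _ => 0)); [rewrite lsum_const; ring|].
      intros m Hm. now apply Hga.
    - intros M. unfold V.
      apply (norm_square_le alpha gamma n A a M ((2 ^ length gamma) ^ 2) Ha Hg HA1 HA2).
      + intros m k Hm Hk Hne. apply covers_Forall2.
        destruct (Hga m Hm) as [[H _] _]. apply H; [|assumption].
        rewrite length_map. destruct (HA2 m Hm). congruence.
      + intros m Hm. destruct (Hga m Hm) as [Hcos [_ [Hbd _]]].
        destruct (HA2 m Hm) as [Hm' _].
        pose proof (cospoly_bessel _ _ _ ((2 ^ length gamma) ^ 2) M Hcos) as H.
        rewrite length_map, Hm' in H. apply H.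
        intros x Hx. apply pow_incr. auto. }
  assert (Hmean : INR (length A) / 2 <= lsum A (fun m => a m (repeat O s))).
  { replace (INR (length A) / 2) with (INR (length A) * (1 / 2)) by field.
    rewrite <- lsum_const. apply lsum_le. intros m Hm. now apply Hga. }
  apply Rle_trans with (2 := Hmain).
  apply Rle_trans with (INR (length A) / 2 / sqrt V).
  2: { apply Rmult_le_compat_r; [|assumption]. left. apply Rinv_0_lt_compat, sqrt_lt_R0, HV0. }
  assert (HsA : 0 < sqrt (INR (length A))) by now apply sqrt_lt_R0.
  assert (HsE : 0 < sqrt (K * (2 ^ s) ^ 2)) by now apply sqrt_lt_R0.
  assert (Hsq : 0 < sqrt (q ^ n)) by now apply sqrt_lt_R0.
  assert (Heq : INR (length A) / 2 / sqrt V
    = / (2 * sqrt (K * (2 ^ s) ^ 2)) * sqrt (INR (length A)) * sqrt (q ^ n)).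
  { rewrite HV, sqrt_mult by (lra || (left; now apply Rdiv_lt_0_compat)).
    rewrite sqrt_div by lra.
    rewrite <- (sqrt_sqrt (INR (length A))) at 1 by lra. field. lra. }
  rewrite Heq.
  assert (HNpos : 2 <= INR N) by (apply (le_INR 2); assumption).
  assert (HlnN : 0 < ln (INR N)) by (rewrite <- ln_1; apply ln_increasing; lra).
  assert (Hpow2 : 2 ^ n = INR (2 ^ n)) by (rewrite pow_INR; reflexivity).
  assert (Hs1 : INR s - 1 = INR (s - 1)) by (rewrite minus_INR by lia; reflexivity).
  assert (HlogN : ln (INR N) <= INR n).
  { apply Rle_trans with (ln (2 ^ n)).
    - left. apply ln_increasing; [lra|]. rewrite Hpow2. apply lt_INR. lia.
    - rewrite ln_pow by lra. pose proof (pos_INR n).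
      assert (ln 2 < 1) by (rewrite <- (ln_exp 1); apply ln_increasing; [lra|];
        pose proof (exp_ineq1 1); lra).
      nra. }
  (* This is the square root of the cardinality bound [HA3], with [n] replaced by the smaller
     [ln (INR N)]. *)
  assert (Hcard : Rpower (/ INR s) ((INR s - 1) / 2) * Rpower (ln (INR N)) ((INR s - 1) / 2)
                  <= sqrt (INR (length A))).
  { pose proof (Rinv_0_lt_compat _ HINRs).
    rewrite Rpower_mult_distr by assumption.
    rewrite <- Rpower_sqrt by assumption.
    replace ((INR s - 1) / 2) with (INR (s - 1) * / 2) by (rewrite Hs1; field).
    assert (0 < / INR s * ln (INR N)) by now apply Rmult_lt_0_compat.
    rewrite <- Rpower_mult, Rpower_pow by assumption.
    apply Rle_Rpower_l; [lra|]. split; [now apply pow_lt|].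
    apply Rle_trans with (2 := HA3). apply pow_incr. split; [lra|].
    unfold Rdiv. rewrite Rmult_comm. apply Rmult_le_compat_r; lra. }
  (* Here [sqrt (q ^ n) = (2 ^ n)^(- alpha)], and [2 ^ n <= 4 N]. *)
  assert (Hrate : Rpower (/ 4) alpha / Rpower (INR N) alpha <= sqrt (q ^ n)).
  { unfold Rdiv. rewrite <- Rpower_Ropp.
    replace (Rpower (INR N) (- alpha)) with (Rpower (/ INR N) alpha)
      by (unfold Rpower; rewrite ln_Rinv by lra; f_equal; ring).
    assert (0 < / INR N) by (apply Rinv_0_lt_compat; lra).
    rewrite Rpower_mult_distr by lra.
    rewrite <- Rpower_sqrt by assumption.
    unfold q. rewrite <- Rpower_pow, !Rpower_mult by apply exp_pos.
    replace (-2 * alpha * (INR n * / 2)) with (INR n * - alpha) by field.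
    rewrite <- Rpower_mult, Rpower_pow by lra.
    assert (0 < 2 ^ n) by (apply pow_lt; lra).
    replace (Rpower (2 ^ n) (- alpha)) with (Rpower (/ 2 ^ n) alpha)
      by (unfold Rpower; rewrite ln_Rinv by lra; f_equal; ring).
    apply Rle_Rpower_l; [lra|]. split; [apply Rmult_lt_0_compat; lra|].
    rewrite <- Rinv_mult. apply Rinv_le_contravar; [assumption|].
    rewrite Hpow2. replace (4 * INR N) with (INR (4 * N)) by (rewrite mult_INR; simpl; ring).
    apply le_INR. lia. }
  replace (/ (2 * sqrt (K * (2 ^ s) ^ 2)) * Rpower (/ INR s) ((INR s - 1) / 2) *
     Rpower (/ 4) alpha * Rpower (ln (INR N)) ((INR s - 1) / 2) / Rpower (INR N) alpha)
    with (/ (2 * sqrt (K * (2 ^ s) ^ 2)) *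
     (Rpower (/ INR s) ((INR s - 1) / 2) * Rpower (ln (INR N)) ((INR s - 1) / 2)) *
     (Rpower (/ 4) alpha / Rpower (INR N) alpha)) by (unfold Rdiv; ring).
  assert (Hpos : forall x y, 0 < Rpower x y) by (intros; apply exp_pos).
  apply Rmult_le_compat.
  - apply Rmult_le_pos; [left; apply Rinv_0_lt_compat; lra|].
    left; now apply Rmult_lt_0_compat.
  - left. now apply Rdiv_lt_0_compat.
  - apply Rmult_le_compat_l; [left; apply Rinv_0_lt_compat; lra|exact Hcard].
  - exact Hrate.
Qed.
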